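(* Let $C$ be a smooth projective curve of genus $g$ over an algebraically closed field, and let $d\ge r\ge 1$ be integers. Let $R$, $G(t)\in R[t]$ and $H(u,t)\in R[u,t]$ be the algebra and polynomials attached to $C$ in the context. Then the following two sets of relations are equivalent: (a) $\deg_t\bigl[G(t)^s\bigr]\le d-r+s$ for all $s$ with $1\le s\le r$; (b) for all $s$ with $1\le s\le r$, the coefficient of $u^{d-r+s}$ in the polynomial $\frac{1}{1+u}H(u,t)^s$ is $0$ in $R[t]$.
   Context: For an abelian variety $X$ let $A(X)=\bigoplus A^i_{(j)}(X)$ be the Chow ring of $X$ with rational coefficients modulo algebraic equivalence, with Beauville's double grading: $i$ is the codimension and $A^i_{(j)}(X)$ is the part on which $k^*$ acts as $k^{2i-j}$ for all $k\in\mathbb Z$ (with $k$ denoting multiplication by $k$ on $X$). The Pontryagin product $x\ast y$ is the push-forward of the exterior product under addition $X\times X\to X$. For $J=\mathrm{Jac}(C)$, let $[C]\in A^{g-1}(J)$ be the class of the image of $C$ under an Abel-Jacobi map, and write $[C]=\sum_{j=0}^{g-1}C_{(j)}$ with $C_{(j)}\in A^{g-1}_{(j)}(J)$. Let $R$ be the (commutative) $\mathbb Q$-subalgebra, with respect to the Pontryagin product, of $A(J)$ generated by the classes $C_{(j)}$, $0\le j\le g-1$. All products and powers in $R[t]$ and $R[u,t]$ are taken with respect to the Pontryagin product. For $n\ge1$ put $$P_n(u)=\sum_{i=1}^\infty i^{n-1}\Bigl(\frac{u}{1+u}\Bigr)^i\in\mathbb Z[[u]],$$ which is in fact a polynomial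 in $u$, divisible by $1+u$ for $n>1$. Define $$G(t)=\sum_{a=0}^{g-1}(a+1)!\,C_{(a)}\,t^{a+2}\in R[t],\qquad H(u,t)=\sum_{a=0}^{g-1}P_{a+2}(u)\,C_{(a)}\,t^{a+2}\in R[u,t].$$ The zero polynomial has degree $-\infty$. (Relations (a) are those obtained from van der Geer-Kouvidakis's theorem for a curve with a base point free $g^r_d$, and (b) are Herbaut's relations.) *)

(* Defs.v *)
From HB Require Import structures.
From mathcomp Require Import all_boot all_order all_algebra.
From mathcomp Require Import mpoly ring.
From mathcomp Require Import boolp classical_sets.

Set Implicit Arguments.
Unset Strict Implicit.
Unset Printing Implicit Defensive.

Import Order.TTheory GRing.Theory Num.Theory.
Local Open Scope classical_set_scope.
Local Open Scope ring_scope.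

(** Varieties are taken in the sense of Serre (FAC): a set of closed points
    with a Zariski topology and a sheaf of [k]-valued functions, locally
    isomorphic to an affine algebraic set.  All spaces live on a carrier
    [car X] inside an ambient type [pt X], so that functions and maps are total
    on the ambient type and a subspace keeps the ambient type.  [reg U f] says
    that [f] is a regular function on the open set [U]; the values of [f]
    outside [U] are irrelevant. *)

Record kspace (k : closedFieldType) := Space {
  pt :> Type;
  car : set pt;
  open : set pt -> Prop;
  reg : set pt -> (pt -> k) -> Prop }.

Arguments car {k} X : rename.
Arguments open {k} X U : rename.
Arguments reg {k} X U f : rename.

Section Spaces.
Variable k : closedFieldType.
Implicit Types X Y : kspace k.

Definition is_space X : Prop :=
  [/\ open X (car X) /\ (forall U, open X U -> U `<=` car X),
      forall F : set (set X), (forall U, F U -> open X U) ->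
        open X (\bigcup_(U in F) U),
      forall U V, open X U -> open X V -> open X (U `&` V),
      forall U f, open X U ->
        (reg X U f <-> forall x, U x ->
           exists V, [/\ open X V, V x, V `<=` U & reg X V f]) &
      forall U (f h : X -> k), (forall x, U x -> f x = h x) ->
        reg X U f -> reg X U h].

Definition closed X (Z : set X) : Prop := Z `<=` car X /\ open X (car X `\` Z).

(** The space on [D] whose regular functions are locally the fractions [p / q]
    with [F p q], and whose basic open sets are the loci [q != 0]. *)
Definition fraction_space (T : Type) (D : set T)
    (F : (T -> k) -> (T -> k) -> Prop) : kspace k :=
  @Space k T D
    (fun U => U `<=` D /\ forall x, U x -> exists p q,
       [/\ F p q, q x != 0 & forall y, D y -> q y != 0 -> U y])
    (fun U f => forall x, U x -> exists p q,
       [/\ F p q, q x != 0 & forall y, U y -> q y != 0 -> f y = p y / q y]).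

Definition affine_space (n : nat) : kspace k :=
  @fraction_space ('I_n -> k) setT (fun p q => exists P Q : {mpoly k[n]},
    p = (fun x => P.@[x]) /\ q = (fun x => Q.@[x])).

(** A point of projective space is represented by its unique homogeneous
    coordinate vector whose first nonzero coordinate is 1. *)
Definition projective_space (n : nat) : kspace k :=
  @fraction_space ('I_n.+1 -> k)
    [set x : 'I_n.+1 -> k | exists i, x i = 1 /\ forall j : 'I_n.+1, (j < i)%N -> x j = 0]
    (fun p q => exists (d : nat) (P Q : {mpoly k[n.+1]}),
      [/\ P \is d.-homog, Q \is d.-homog,
          p = (fun x => P.@[x]) & q = (fun x => Q.@[x])]).

Definition subspace X (V : set X) : kspace k :=
  @Space k X V
    (fun W => exists U, open X U /\ W = U `&` V)
    (fun W f => forall x, W x -> exists U h,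
       [/\ open X U, U x, reg X U h & forall y, W y -> U y -> f y = h y]).

Definition tensor_function X Y (U : set X) (V : set Y) (h : X * Y -> k) : Prop :=
  exists (n : nat) (a : 'I_n -> X -> k) (b : 'I_n -> Y -> k),
    [/\ forall i, reg X U (a i), forall i, reg Y V (b i) &
        forall x y, U x -> V y -> h (x, y) = \sum_i a i x * b i y].

(** The topology is the Zariski topology of the product, not the product of the
    Zariski topologies. *)
Definition product X Y : kspace k :=
  @fraction_space (X * Y)%type (car X `*` car Y) (fun p q => exists U V,
    [/\ open X U, open Y V, tensor_function U V p, tensor_function U V q &
        forall z, ~ (U `*` V) z -> q z = 0]).

Definition morphism X Y (F : X -> Y) : Prop :=
  [/\ forall x, car X x -> car Y (F x),
      forall U, open Y U -> open X (car X `&` F @^-1` U) &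
      forall U h, open Y U -> reg Y U h ->
        reg X (car X `&` F @^-1` U) (h \o F)].

Definition isomorphic X Y : Prop :=
  exists (F : X -> Y) (G : Y -> X), [/\ morphism F, morphism G,
    forall x, car X x -> G (F x) = x & forall y, car Y y -> F (G y) = y].

Definition affine X : Prop :=
  exists n (Z : set (affine_space n)),
    closed Z /\ isomorphic X (subspace Z).

Definition projective X : Prop :=
  exists n (Z : set (projective_space n)),
    closed Z /\ isomorphic X (subspace Z).

(** Separated, of finite type and reduced; not necessarily irreducible. *)
Definition variety X : Prop :=
  [/\ is_space X,
      exists (m : nat) (U : 'I_m -> set X),
        [/\ forall i, open X (U i), forall x, car X x -> exists i, U i x &
            forall i, affine (subspace (U i))] &
      @closed (product X X) [set z | car X z.1 /\ z.1 = z.2]].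

Definition complete X : Prop :=
  variety X /\ forall Y, variety Y ->
    forall Z : set (product X Y), closed Z -> @closed Y (snd @` Z).

Definition subvariety X (Z : set X) : Prop :=
  [/\ closed Z, Z !=set0 &
      forall A B, closed A -> closed B -> Z `<=` A `|` B ->
        Z `<=` A \/ Z `<=` B].

Definition irreducible_component X (S Z : set X) : Prop :=
  [/\ subvariety Z, Z `<=` S &
      forall Z', subvariety Z' -> Z `<=` Z' -> Z' `<=` S -> Z' = Z].

Definition dim_ge X (n : nat) : Prop :=
  exists Z : nat -> set X, (forall i, (i <= n)%N -> subvariety (Z i)) /\
    (forall i, (i < n)%N -> Z i `<` Z i.+1).

Definition has_dim X (n : nat) : Prop := dim_ge X n /\ ~ dim_ge X n.+1.

(** For [Z] irreducible, the local ring of [X] along [Z] consists of the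
    functions satisfying [germ Z], up to [germ_eq Z].  For [X] irreducible and
    [Z = car X] this is the function field of [X]. *)
Definition germ X (Z : set X) (f : X -> k) : Prop :=
  exists U, [/\ open X U, U `&` Z !=set0 & reg X U f].

Definition germ_eq X (Z : set X) (f h : X -> k) : Prop :=
  exists U, [/\ open X U, U `&` Z !=set0 & forall x, U x -> f x = h x].

Definition germ_ideal X (Z : set X) (I : set (X -> k)) : Prop :=
  [/\ I `<=` germ Z /\ I (fun=> 0),
      forall f h, I f -> germ Z h -> germ_eq Z f h -> I h,
      forall f h, I f -> I h -> I (fun x => f x + h x) &
      forall a f, germ Z a -> I f -> I (fun x => a x * f x)].

(** The local rings of [X], of dimension [n] at each point, are regular: the
    maximal ideal is generated by [n] elements. *)
Definition nonsingular X (n : nat) : Prop :=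
  forall x, car X x -> exists t : 'I_n -> X -> k,
    (forall i, germ [set x] (t i) /\ t i x = 0) /\
    forall f, germ [set x] f -> f x = 0 ->
      exists a : 'I_n -> X -> k, (forall i, germ [set x] (a i)) /\
        germ_eq [set x] f (fun y => \sum_i a i y * t i y).

Definition smooth_curve X : Prop :=
  [/\ variety X, subvariety (car X), has_dim X 1 & nonsingular X 1].

(** [dim H^1(X, O_X) = g] for a projective curve [X]: the complements of two
    distinct points form an affine cover of [X], and [H^1] is computed by the
    Cech complex of this cover. *)
Definition genus X (g : nat) : Prop :=
  forall p q, car X p -> car X q -> p <> q ->
    exists b : 'I_g -> X -> k,
      (forall i, reg X (car X `\` [set p; q]) (b i)) /\
      forall f, reg X (car X `\` [set p; q]) f ->
        exists! c : {ffun 'I_g -> k}, exists f1 f2,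
          [/\ reg X (car X `\` [set p]) f1, reg X (car X `\` [set q]) f2 &
              forall x, (car X `\` [set p; q]) x ->
                f x = f1 x + f2 x + \sum_i c i * b i x].

(** There is a chain of length [n] of ideals of the local ring [O_(X,Z)]
    containing the ideal of the scheme-theoretic inverse image of [W]. *)
Definition length_ge X Y (F : X -> Y) (W : set Y) (Z : set X) (n : nat) : Prop :=
  exists I : nat -> set (X -> k),
    [/\ forall i, (i <= n)%N -> germ_ideal Z (I i),
        forall i, (i < n)%N -> I i `<` I i.+1 &
        forall U h, open Y U -> U `&` (F @` Z) !=set0 -> reg Y U h ->
          (forall y, U y -> W y -> h y = 0) -> I 0%N (h \o F)].

Definition multiplicity X Y (F : X -> Y) (W : set Y) (Z : set X) (n : nat) :=
  length_ge F W Z n /\ ~ length_ge F W Z n.+1.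

(** For [F] flat, the cycle [\sum_i mu i [Z i]] is [F^*[W]], i.e. the
    fundamental cycle of the scheme-theoretic inverse image of [W]. *)
Definition flat_pullback X Y (F : X -> Y) (W : set Y)
    (m : nat) (Z : 'I_m -> set X) (mu : 'I_m -> nat) : Prop :=
  [/\ injective Z,
      forall S, irreducible_component (car X `&` F @^-1` W) S <->
        exists i, Z i = S &
      forall i, multiplicity F W (Z i) (mu i)].

(** For [F] dominant and [X], [Y] irreducible: [[k(X) : k(Y)] = n]. *)
Definition map_degree X Y (F : X -> Y) (n : nat) : Prop :=
  exists b : 'I_n -> X -> k,
    [/\ forall i, germ (car X) (b i),
        forall f, germ (car X) f -> exists c : 'I_n -> Y -> k,
          (forall i, germ (car Y) (c i)) /\
          germ_eq (car X) f (fun x => \sum_i c i (F x) * b i x) &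
        forall c : 'I_n -> Y -> k, (forall i, germ (car Y) (c i)) ->
          germ_eq (car X) (fun=> 0) (fun x => \sum_i c i (F x) * b i x) ->
          forall i, germ_eq (car Y) (c i) (fun=> 0)].

End Spaces.

Record abelian_variety (k : closedFieldType) := AbelianVariety {
  av_space :> kspace k;
  av_zero : av_space;
  av_add : av_space * av_space -> av_space;
  av_opp : av_space -> av_space;
  av_complete : complete av_space;
  av_irreducible : subvariety (car av_space);
  av_car0 : car av_space av_zero;
  av_addM : @morphism k (product av_space av_space) av_space av_add;
  av_oppM : @morphism k av_space av_space av_opp;
  av_addA : forall x y z,
    car av_space x -> car av_space y -> car av_space z ->
    av_add (x, av_add (y, z)) = av_add (av_add (x, y), z);
  av_addC : forall x y,
    car av_space x -> car av_space y -> av_add (x, y) = av_add (y, x);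
  av_add0 : forall x, car av_space x -> av_add (av_zero, x) = x;
  av_addN : forall x, car av_space x -> av_add (av_opp x, x) = av_zero }.

Arguments av_add {k} X : rename.
Arguments av_opp {k} X : rename.
Arguments av_zero {k} X : rename.

Section Jacobian.
Variable k : closedFieldType.
Implicit Types J B : abelian_variety k.

Definition av_hom J B (f : J -> B) : Prop :=
  morphism f /\ forall x y, car J x -> car J y ->
    f (av_add J (x, y)) = av_add B (f x, f y).

Definition av_mulz J (n : int) (x : J) : J :=
  match n with
  | Posz m => iter m (fun y => av_add J (x, y)) (av_zero J)
  | Negz m => av_opp J (iter m.+1 (fun y => av_add J (x, y)) (av_zero J))
  end.

(** [J] is the Jacobian of the curve [C] and [phi] its Abel-Jacobi map for the
    base point [p0], i.e. the universal map from the pointed curve [(C, p0)] to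
    an abelian variety. *)
Definition abel_jacobi (C : kspace k) J (phi : C -> J) : Prop :=
  morphism phi /\ exists p0, [/\ car C p0, phi p0 = av_zero J &
    forall B (psi : C -> B), morphism psi -> psi p0 = av_zero B ->
      exists f : J -> B,
        [/\ av_hom f, forall x, car C x -> psi x = f (phi x) &
            forall f' : J -> B, av_hom f' ->
              (forall x, car C x -> psi x = f' (phi x)) ->
              forall y, car J y -> f' y = f y]].

End Jacobian.

Section Chow.
Variable k : closedFieldType.

(** The assignment [h] of vectors to subvarieties is compatible with algebraic
    equivalence: for every smooth curve [T] and every subvariety [V] of
    [X x T] dominating [T], hence flat over [T], any two fibres of [V] have the
    same image. *)
Definition respects_alg_equiv (X : kspace k) (M : lmodType rat)
    (h : set X -> M) : Prop :=
  forall (T : kspace k) (V : set (product X T)),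
    smooth_curve T -> subvariety V ->
    (forall U, open T U -> U !=set0 -> exists z, V z /\ U z.2) ->
    forall (a b : T) m Z mu m' Z' mu', car T a -> car T b ->
      @flat_pullback k (subspace V) T snd [set a] m Z mu ->
      @flat_pullback k (subspace V) T snd [set b] m' Z' mu' ->
      \sum_i (mu i)%:R *: h [set x | Z i (x, a)] =
      \sum_i (mu' i)%:R *: h [set x | Z' i (x, b)].

(** [A], with [cl Z] for the class of a subvariety [Z], is the [rat]-vector
    space of cycles on [X] modulo algebraic equivalence: it is generated by
    the symbols [cl Z] subject to the relations of algebraic equivalence. *)
Definition chow_group (X : kspace k) (A : lmodType rat) (cl : set X -> A) :=
  respects_alg_equiv cl /\
  forall (M : lmodType rat) (h : set X -> M), respects_alg_equiv h ->
    exists f : {linear A -> M},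
      (forall Z, subvariety Z -> f (cl Z) = h Z) /\
      forall f' : {linear A -> M},
        (forall Z, subvariety Z -> f' (cl Z) = h Z) -> f' =1 f.

(** [x] is the class of the push-forward of the cycle [[V]] by [F]. *)
Definition pushforward_class (X Y : kspace k) (F : X -> Y) (V : set X)
    (A : lmodType rat) (cl : set Y -> A) (x : A) : Prop :=
  exists a b,
    [/\ has_dim (subspace V) a, has_dim (@subspace k Y (F @` V)) b,
        a = b -> exists n, @map_degree k (subspace V) (@subspace k Y (F @` V)) F n /\
                   x = n%:R *: cl (F @` V) &
        a <> b -> x = 0].

Variable J : abelian_variety k.

(** [A] is the Chow group of [J] modulo algebraic equivalence, with the
    Pontryagin product as its multiplication. *)
Definition pontryagin_chow_ring (A : comAlgType rat) (cl : set J -> A) : Prop :=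
  chow_group cl /\
  forall V W : set J, subvariety V -> subvariety W ->
    pushforward_class (X := product J J) (av_add J) (V `*` W) cl (cl V * cl W).

Variables (A : lmodType rat) (cl : set J -> A).

Definition codim_part (i : nat) (x : A) : Prop :=
  exists (n : nat) (V : 'I_n -> set J) (q : 'I_n -> rat),
    (forall l, subvariety (V l) /\
       exists e, has_dim (subspace (V l)) e /\ has_dim J (e + i)) /\
    x = \sum_l q l *: cl (V l).

(** [f] is the pull-back by multiplication by [n].  For [n != 0] the latter is
    flat; for [n = 0] it is the constant map, under which the pull-back of a
    class of positive codimension vanishes. *)
Definition mulz_pullback (n : int) (f : {linear A -> A}) : Prop :=
  if n == 0 then
    f (cl (car J)) = cl (car J) /\
    forall V, subvariety V -> V <> car J -> f (cl V) = 0
  else forall V, subvariety V -> exists m Z mu,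
    @flat_pullback k J J (@av_mulz k J n) V m Z mu /\
    f (cl V) = \sum_i (mu i)%:R *: cl (Z i).

(** The summand [A^i_(j)] of Beauville's decomposition. *)
Definition beauville_part (i j : nat) (x : A) : Prop :=
  codim_part i x /\
  forall n : int, exists f : {linear A -> A},
    mulz_pullback n f /\ f x = (n%:~R : rat) ^ ((2 * i)%:Z - j%:Z) *: x.

(** [c j] is the component of [[phi(C)]] in [A^(g-1)_(j)].  For [g = 0] there
    are no components and no class in codimension [g - 1]. *)
Definition curve_components (C : kspace k) (phi : C -> J) (g : nat)
    (c : 'I_g -> A) : Prop :=
  (forall j : 'I_g, beauville_part g.-1 j (c j)) /\
  ((0 < g)%N -> cl (phi @` car C) = \sum_j c j).

End Chow.

Definition generates_algebra (R : comAlgType rat) (g : nat) (c : 'I_g -> R) :=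
  forall S : set R, S 1 ->
    (forall q x y, S x -> S y -> S (q *: x + y)) ->
    (forall x y, S x -> S y -> S (x * y)) ->
    (forall j, S (c j)) -> forall x, S x.

(** Formal power series in [u] over the integers, as coefficient sequences. *)
Definition series_mul (f h : nat -> int) : nat -> int :=
  fun m => \sum_(i < m.+1) f i * h (m - i)%N.

Definition series_exp (f : nat -> int) (i : nat) : nat -> int :=
  iter i (series_mul f) (fun m => (m == 0%N)%:R).

(** The series [u / (1 + u) = u - u^2 + u^3 - ...]. *)
Definition u_over_1u (m : nat) : int := if m is m'.+1 then (-1) ^+ m' else 0.

(** The series [\sum_(i >= 1) i^(n-1) (u / (1 + u))^i].  Since [(u / (1+u))^i]
    has order [i], only the terms [i <= m] contribute to the coefficient of
    [u^m]. *)
Definition P_series (n m : nat) : int :=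
  \sum_(1 <= i < m.+1) (i ^ n.-1)%:R * series_exp u_over_1u i m.

(** No coefficient is lost by the truncation, see [coef_P_poly]. *)
Definition P_poly (n : nat) : {poly int} := \poly_(m < n.+1) P_series n m.

Section GH.
Variables (R : comAlgType rat) (g : nat) (c : 'I_g -> R).

Definition G_poly : {poly R} :=
  \sum_(a < g) ((a.+1)`!%:R * c a) *: 'X^(a.+2).

(** [H(u,t)] as a polynomial in [u] with coefficients in [R[t]]. *)
Definition H_poly : {poly {poly R}} :=
  \sum_(a < g) (c a *: 'X^(a.+2)) *: map_poly intr (P_poly a.+2).

(** [H(u,t)^s / (1 + u)]: quotient by the monic polynomial [1 + u]; the division
    is exact, see [H_quotE]. *)
Definition H_quot (s : nat) : {poly {poly R}} :=
  Pdiv.Ring.rdivp (H_poly ^+ s) (1 + 'X).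

End GH.

Section Facts.

Local Notation x_ i m := (series_exp u_over_1u i m).

Lemma series_mul_rec (f : nat -> int) (m : nat) :
  series_mul u_over_1u f m.+1 = f m - series_mul u_over_1u f m.
Proof.
rewrite /series_mul big_ord_recl /= mul0r add0r big_ord_recl /=.
rewrite [in X in _ = _ - X]big_ord_recl /= mul0r add0r subn1 /= mul1r.
by congr (_ + _); rewrite -sumrN; apply: eq_bigr => i _; rewrite exprS -!mulrA !mulN1r.
Qed.

Lemma series_expS0 i : x_ i.+1 0 = 0.
Proof. by rewrite /= /series_mul big_ord1 /= mul0r. Qed.

Lemma series_exp_rec i m : x_ i.+1 m.+1 = x_ i m - x_ i.+1 m.
Proof. exact: series_mul_rec. Qed.

Lemma series_exp_small i m : (m < i)%N -> x_ i m = 0.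
Proof.
elim: m i => [|m IH] [|i] //; first by move=> _; exact: series_expS0.
by move=> lt_mi; rewrite series_exp_rec !IH ?subr0 // ltnW.
Qed.

Lemma series_exp_diff i m :
  i%:R * x_ i m.+1 = m.+1%:R * x_ i m.+1 + m%:R * x_ i m.
Proof.
elim: m i => [|m IH] [|i].
- by rewrite /= mulr0 !mul0r mulr0 addr0.
- rewrite series_exp_rec series_expS0 subr0 mul0r addr0.
  by case: i => [|i] //; rewrite series_expS0 !mulr0.
- by rewrite mul0r /= !mulr0 addr0.
have e1 := IH i; have e2 := IH i.+1.
have e3 := series_exp_rec i m; have e4 := series_exp_rec i m.+1.
move: e1 e2 e3 e4.
set a := x_ i m.+1; set b := x_ i.+1 m.+1; set p := x_ i.+1 m.+2.
set q := x_ i m; set w := x_ i.+1 m => e1 e2 e3 e4.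
have Sn n : n.+1%:R = n%:R + 1 :> int by rewrite -natr1.
have {}e3 : q = b + w by rewrite e3 subrK.
rewrite e4 mulrBr e2 {1}Sn mulrDl e1 e3 !Sn; ring.
Qed.

Lemma P_series1 m : P_series 1 m = (m == 1%N)%:R.
Proof.
rewrite /P_series; under eq_bigr => i _ do rewrite expn0 mul1r.
case: m => [|m]; first by rewrite big_nil.
elim: m => [|m IH]; first by rewrite big_nat1 /= /series_mul !big_ord_recl big_ord0 /=.
have -> : \sum_(1 <= i < m.+3) x_ i m.+2 =
    \sum_(1 <= i < m.+3) (x_ i.-1 m.+1 - x_ i m.+1).
  by apply: eq_big_nat => -[|i] // _; rewrite series_exp_rec.
rewrite (@telescope_sumr_eq _ _ _ (fun i => - x_ i.-1 m.+1)) //.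
  by rewrite [m.+3.-1]/= [1.-1]/= series_exp_small // oppr0 add0r opprK.
by move=> i _; rewrite opprK addrC.
Qed.

Lemma P_seriesS n m :
  P_series n.+2 m.+1 = m.+1%:R * P_series n.+1 m.+1 + m%:R * P_series n.+1 m.
Proof.
rewrite /P_series [n.+2.-1]/= [n.+1.-1]/= !mulr_sumr.
have -> : \sum_(1 <= i < m.+1) m%:R * ((i ^ n)%:R * x_ i m) =
    \sum_(1 <= i < m.+2) m%:R * ((i ^ n)%:R * x_ i m).
  by rewrite [RHS]big_nat_recr // series_exp_small // !mulr0 [RHS]addr0.
rewrite -big_split; apply: eq_bigr => i _.
by rewrite expnSr natrM -mulrA series_exp_diff mulrDr !(mulrCA (i ^ n)%:R).
Qed.

Lemma P_series0 n : P_series n 0 = 0.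
Proof. by rewrite /P_series big_nil. Qed.

Lemma P_series_gt n m : (n.+1 < m)%N -> P_series n.+1 m = 0.
Proof.
elim: n m => [|n IH] [|m] // lt_nm; first by rewrite P_series1; case: m lt_nm.
by rewrite P_seriesS !IH ?mulr0 ?addr0 // ltnW.
Qed.

Lemma coef_P_poly n m : (0 < n)%N -> (P_poly n)`_m = P_series n m.
Proof.
case: n => // n _; rewrite coef_poly ltnS; case: leqP => // lt_nm.
by rewrite P_series_gt.
Qed.

Lemma P_poly_factor n : P_poly n.+2 = 'X * (P_poly n.+1)^`() * (1 + 'X).
Proof.
apply/polyP => m; rewrite mulrDr mulr1 coefD coefMX coef_P_poly //.
case: m => [|m]; first by rewrite P_series0 coefXM addr0.
rewrite P_seriesS !coefXM /= coef_deriv coef_P_poly // mulr_natl; congr (_ + _).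
case: m => [|m] /=; first by rewrite P_series0 mulr0.
by rewrite coef_deriv coef_P_poly // mulr_natl.
Qed.

Lemma H_quotE (R : comAlgType rat) (g : nat) (c : 'I_g -> R) (s : nat) :
  (0 < s)%N -> H_quot c s * (1 + 'X) = H_poly c ^+ s.
Proof.
move=> s_gt0; have mon1X : (1 + 'X : {poly {poly R}}) \is monic.
  by rewrite addrC -polyC1 monicXaddC.
pose Q := \sum_(a < g) (c a *: 'X^(a.+2)) *:
  map_poly (intr : int -> {poly R}) ('X * (P_poly a.+1)^`()).
have HQ : H_poly c = Q * (1 + 'X).
  rewrite /H_poly mulr_suml; apply: eq_bigr => a _.
  by rewrite P_poly_factor rmorphM /= rmorphD rmorph1 /= map_polyX scalerAl.
rewrite /H_quot; case: s s_gt0 => // s _.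
have -> : H_poly c ^+ s.+1 = H_poly c ^+ s * Q * (1 + 'X).
  by rewrite exprSr -mulrA -HQ.
by rewrite Pdiv.RingMonic.rdivp_mull.
Qed.

End Facts.

(* Main.v *)
(** Substitute [u = 1 / (e^tau - 1)].  Then [P_n(u) = (n-1)! / tau^n + O(1)] at
    [tau = 0], so [H(u, t) = G(t / tau) + E] with [E] regular in [tau], and the
    degree in [u] of a polynomial is its pole order at [tau = 0].  Argue by
    induction on [s], with [N = d - r]: if [deg G^j <= N + j] for [j < s], every
    term of the binomial expansion of [(G(t / tau) + E)^s] except
    [G(t / tau)^s] has pole order less than [N + s].  Hence the coefficient of
    [u^(N+s)] in [H^s / (1 + u)] is that of the sum of [[t^n](G^s) t^n p_n]
    with [p_n = P_n / ((n-1)! (1 + u))], a polynomial of degree [n - 1] with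
    positive coefficients at [u, ..., u^(n-1)]; it vanishes exactly when
    [[t^n](G^s) = 0] for all [n > N + s].

    Laurent series in [tau] are avoided by working with [v = 1/u = e^tau - 1]
    and clearing denominators by powers of [v]. *)

Require Import Defs.
From mathcomp Require Import all_boot all_order all_algebra.
From mathcomp Require Import boolp classical_sets.
From mathcomp Require Import ring zify.

Set Implicit Arguments.
Unset Strict Implicit.
Unset Printing Implicit Defensive.

Import GRing.Theory.
Local Open Scope classical_set_scope.
Local Open Scope ring_scope.

(** * Homogenization of polynomials *)

(** This is [y^D f(x/y)], evaluation at a fraction with denominators cleared. Coefficients of index
    above [D] are lost, hence the size bounds in the product rules. *)
Definition homogenize (A B : comNzRingType) (h : A -> B) (x y : B) (D : nat)
    (f : {poly A}) : B :=
  \sum_(i < D.+1) h f`_i * x ^+ i * y ^+ (D - i).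

Lemma homogenize_sum (A B : comNzRingType) (h : {rmorphism A -> B}) (x y : B)
    (D : nat) (I : Type) (r : seq I) (P : pred I) (F : I -> {poly A}) :
  homogenize h x y D (\sum_(i <- r | P i) F i) =
  \sum_(i <- r | P i) homogenize h x y D (F i).
Proof.
rewrite /homogenize exchange_big; apply: eq_bigr => i _.
by rewrite coef_sum rmorph_sum /= !mulr_suml.
Qed.

Lemma homogenizeB (A B : comNzRingType) (h : {rmorphism A -> B}) (x y : B)
    (D : nat) (f1 f2 : {poly A}) :
  homogenize h x y D (f1 - f2) = homogenize h x y D f1 - homogenize h x y D f2.
Proof.
rewrite /homogenize -sumrB; apply: eq_bigr => i _.
by rewrite coefB rmorphB /= !mulrBl.
Qed.

Lemma homogenizeZ (A B : comNzRingType) (h : {rmorphism A -> B}) (x y : B)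
    (D : nat) (a : A) (f : {poly A}) :
  homogenize h x y D (a *: f) = h a * homogenize h x y D f.
Proof.
rewrite /homogenize mulr_sumr; apply: eq_bigr => i _.
by rewrite coefZ rmorphM /= !mulrA.
Qed.

Lemma homogenize_Xn (A B : comNzRingType) (h : {rmorphism A -> B}) (x y : B)
    (D i : nat) :
  (i <= D)%N -> homogenize h x y D 'X^i = x ^+ i * y ^+ (D - i).
Proof.
rewrite -ltnS => lt_iD; rewrite /homogenize (bigD1 (Ordinal lt_iD)) //= big1.
  by rewrite coefXn eqxx rmorph1 mul1r addr0.
move=> j /negP ne_ji; rewrite coefXn; case: eqP => [e|_].
  by case: ne_ji; apply/eqP/val_inj.
by rewrite rmorph0 !mul0r.
Qed.

Lemma homogenizeM (A B : comNzRingType) (h : {rmorphism A -> B}) (x y : B)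
    (D1 D2 : nat) (f1 f2 : {poly A}) :
  (size f1 <= D1.+1)%N -> (size f2 <= D2.+1)%N ->
  homogenize h x y (D1 + D2) (f1 * f2) =
  homogenize h x y D1 f1 * homogenize h x y D2 f2.
Proof.
move=> sz1 sz2.
have expand D (f : {poly A}) : (size f <= D.+1)%N ->
    f = \sum_(i < D.+1) f`_i *: 'X^i.
  by move=> szf; rewrite -poly_def; apply/polyP => i; rewrite coef_poly;
    case: ltnP => // ge_iD; rewrite nth_default // (leq_trans szf).
rewrite [in LHS](expand _ _ sz1) [in LHS](expand _ _ sz2).
rewrite mulr_suml homogenize_sum [in RHS]/homogenize mulr_suml.
apply: eq_bigr => i _; rewrite mulr_sumr homogenize_sum mulr_sumr.
apply: eq_bigr => j _.
rewrite -scalerAl -scalerAr -exprD !homogenizeZ homogenize_Xn; last first.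
  by rewrite leq_add // -ltnS.
have -> : (D1 + D2 - (i + j) = (D1 - i) + (D2 - j))%N.
  by have := ltn_ord i; have := ltn_ord j; lia.
by rewrite !exprD; ring.
Qed.

Lemma size_exp_le (A : comNzRingType) (D s : nat) (f : {poly A}) :
  (size f <= D.+1)%N -> (size (f ^+ s) <= (D * s).+1)%N.
Proof.
move=> szf; apply: leq_trans (size_poly_exp_leq _ _) _.
by rewrite ltnS leq_mul2r -ltnS (leq_trans (leqSpred _)) ?orbT //; case: (size f) szf.
Qed.

Lemma homogenizeX (A B : comNzRingType) (h : {rmorphism A -> B}) (x y : B)
    (D s : nat) (f : {poly A}) :
  (size f <= D.+1)%N ->
  homogenize h x y (D * s) (f ^+ s) = homogenize h x y D f ^+ s.
Proof.
move=> szf; elim: s => [|s IH].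
  by rewrite muln0 /homogenize big_ord1 coef1 rmorph1 !mul1r.
by rewrite !exprS -IH mulnS homogenizeM // size_exp_le.
Qed.

(** * Reciprocal polynomials: the change of variable [v = 1/u] *)

Notation reciprocal := (homogenize polyC 1 'X).

Lemma reciprocalE (A : comNzRingType) (D : nat) (f : {poly A}) :
  reciprocal D f = \sum_(i < D.+1) f`_i *: 'X^(D - i).
Proof.
by apply: eq_bigr => i _; rewrite expr1n mulr1 mul_polyC.
Qed.

Lemma coef_reciprocal (A : comNzRingType) (D i : nat) (f : {poly A}) :
  (i <= D)%N -> (reciprocal D f)`_(D - i) = f`_i.
Proof.
move=> le_iD; rewrite reciprocalE coef_sum.
have lt_iD : (i < D.+1)%N by [].
rewrite (bigD1 (Ordinal lt_iD)) //= big1 ?coefZ ?coefXn ?eqxx ?mulr1 ?addr0 //.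
move=> j /negP ne_ji; rewrite coefZ coefXn; case: eqP => [e|_]; rewrite ?mulr0 //.
by case: ne_ji; apply/eqP/val_inj => /=; have := ltn_ord j; lia.
Qed.

Lemma reciprocal_add (A : comNzRingType) (D e : nat) (f : {poly A}) :
  (size f <= D.+1)%N -> reciprocal (D + e) f = reciprocal D f * 'X^e.
Proof.
move=> szf; rewrite -[f in LHS]mulr1 homogenizeM ?size_poly1 //.
by rewrite -(expr0 'X) homogenize_Xn // subn0 expr0 mul1r.
Qed.

(** For [v = 1/u] one has [u d/du = - v d/dv]; differentiating the prefactor [v^D] produces the term
    with [D]. *)
Lemma reciprocal_Xderiv (A : comNzRingType) (D : nat) (f : {poly A}) :
  reciprocal D ('X * f^`()) =
  D%:R * reciprocal D f - 'X * (reciprocal D f)^`().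
Proof.
rewrite !reciprocalE raddf_sum /= !mulr_sumr -sumrB; apply: eq_bigr => i _.
rewrite coefXM derivZ derivXn -!scalerAr.
have -> : (if i == 0%N :> nat then 0 else (f^`())`_i.-1) = f`_i *+ i.
  by case: (nat_of_ord i) => [|j] //=; rewrite coef_deriv.
have le_iD : (i <= D)%N by rewrite -ltnS.
have -> : 'X * ('X^((D - i).-1) *+ (D - i)) = 'X^(D - i) *+ (D - i) :> {poly A}.
  by case: (D - i)%N => [|j]; rewrite ?mulr0n ?mulr0 //= mulrnAr exprS.
rewrite mulr_natl -!scalerMnr -mulrnBr ?leq_subr // subKn //.
by rewrite -scalerMnl.
Qed.

Lemma size_Xderiv (A : comNzRingType) (D : nat) (f : {poly A}) :
  (size f <= D.+1)%N -> (size ('X * f^`())%R <= D.+1)%N.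
Proof.
move=> szf; apply/leq_sizeP => -[|i] // lt_Di.
by rewrite coefXM /= coef_deriv nth_default ?mul0rn // (leq_trans szf).
Qed.

(** * The polar part of [P_n] at [tau = 0] *)

(* The series [m(v) = v / log(1 + v)] truncated at order [K]: since
    [(1 + v) log'(1 + v) = 1], it solves [m^2 = (1 + v) (m - v m')]. *)
Lemma exists_truncated_v_over_log (K : nat) : exists m e : {poly rat},
  m`_0 = 1 /\ m ^+ 2 = (1 + 'X) * (m - 'X * m^`()) + e * 'X^(K.+1).
Proof.
elim: K => [|K [m [e [m0 eq_m]]]].
  exists 1, (-1); rewrite coef1 -polyC1 derivC; split=> //; ring.
have [m1 def_m] : exists m1, m = 1 + m1 * 'X.
  exists (m %/ 'X); rewrite {1}(divp_eq m 'X) addrC; congr (_ + _).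
  have := modp_XsubC m 0; rewrite polyC0 subr0 => ->.
  by rewrite horner_coef0 m0.
have [e1 def_e] : exists e1, e = (e`_0)%:P + e1 * 'X.
  exists (e %/ 'X); rewrite {1}(divp_eq e 'X) addrC; congr (_ + _).
  by have := modp_XsubC e 0; rewrite polyC0 subr0 => ->; rewrite horner_coef0.
(* Adding [a v^(K+1)] to [m] changes the coefficient of [v^(K+1)] in [m^2 - (1 + v) (m - v m')] by
   [2 a + K a], which must cancel [e_0]. *)
pose a : rat := - e`_0 / K.+2%:R.
have def_e0 : (e`_0)%:P = - (K.+2%:R * a%:P) :> {poly rat}.
  by rewrite /a -polyC_natr -polyCM -polyCN mulrC divfK ?Num.Theory.pnatr_eq0 // opprK.
exists (m + a%:P * 'X^(K.+1)).
exists (e1 + 2%:R * m1 * a%:P + a%:P ^+ 2 * 'X^K + K%:R * a%:P); split.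
  by rewrite coefD m0 coefCM coefXn mulr0 addr0.
rewrite derivD derivM derivC mul0r add0r derivXn /=.
have -> : (m + a%:P * 'X^(K.+1)) ^+ 2 =
    m ^+ 2 + 2%:R * m * a%:P * 'X^(K.+1) + (a%:P * 'X^(K.+1)) ^+ 2 by ring.
rewrite eq_m def_e def_e0 -mulr_natr def_m !derivE !exprS.
by rewrite -!natr1; ring.
Qed.

Definition P_rat (n : nat) : {poly rat} := map_poly intr (P_poly n).

Lemma P_rat1 : P_rat 1 = 'X.
Proof.
apply/polyP => i; rewrite coef_map coef_P_poly // P_series1 coefX.
by case: (i == 1%N).
Qed.

Lemma P_ratSS n : P_rat n.+2 = 'X * (P_rat n.+1)^`() * (1 + 'X).
Proof.
by rewrite /P_rat P_poly_factor !rmorphM rmorphD rmorph1 /= !map_polyX deriv_map.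
Qed.

Lemma size_P_rat n : (size (P_rat n) <= n.+1)%N.
Proof. by rewrite (leq_trans (size_poly _ _)) // size_poly. Qed.

(** The recursion gives [i p_i + (i-1) p_(i-1)] as the coefficient of [u^i] in [P_(n+2)], where
    [p_i] are the coefficients of [P_(n+1)]. Both terms are nonnegative, so nothing cancels. *)
Lemma coef_P_rat_gt0 n i : (1 <= i <= n)%N -> 0 < (P_rat n)`_i :> rat.
Proof.
elim: n i => [|[|n] IH] i; first by case: i.
  by rewrite P_rat1 coefX; case: i => [|[]].
have ge0 j : 0 <= (P_rat n.+1)`_j :> rat.
  case: (boolP (1 <= j <= n.+1)%N) => [/IH /Order.POrderTheory.ltW //|].
  rewrite negb_and -leqNgt -ltnNge leqn0 => /orP[/eqP ->|lt_nj].
    case: {IH} n => [|n]; first by rewrite P_rat1 coefX.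
    by rewrite P_ratSS -mulrA coefXM.
  by rewrite nth_default // (leq_trans (size_P_rat _)).
case/andP; case: i => // i _ le_in.
rewrite P_ratSS -mulrA coefXM /= mulrDr mulr1 coefD coefMX coef_deriv.
have pos j : (1 <= j <= n.+1)%N -> 0 < (P_rat n.+1)`_j *+ j :> rat.
  by move=> jP; rewrite Num.Theory.pmulrn_lgt0 ?IH //; case/andP: jP.
have nneg j k : 0 <= (P_rat n.+1)`_j *+ k :> rat.
  exact: Num.Theory.mulrn_wge0.
case: i le_in => [|i] le_in /=; first by rewrite addr0 pos.
by rewrite coef_deriv Num.Theory.ltr_wpDl // pos //.
Qed.

(* [P_n = theta^(n-1) u] for [theta = u(1+u) d/du = - d/dtau], where
    [u = 1 / (e^tau - 1)]; hence [P_n - (n-1)! / tau^n] is regular at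
    [tau = 0]. In the variable [v = 1/u] one has [1 / tau = m / v]. *)
Lemma reciprocal_P_rat (K n : nat) (m e : {poly rat}) :
  m`_0 = 1 -> m ^+ 2 = (1 + 'X) * (m - 'X * m^`()) + e * 'X^K ->
  (n < K)%N ->
  exists E, reciprocal n.+1 (P_rat n.+1) = n`!%:R * m ^+ n.+1 + 'X^(n.+1) * E.
Proof.
move=> m0 eq_m; elim: n => [|n IH] lt_nK.
  exists (- (m %/ 'X)).
  rewrite P_rat1 -[X in reciprocal _ X]expr1 homogenize_Xn // !expr1 subnn mul1r.
  rewrite {1}(divp_eq m 'X); have := modp_XsubC m 0; rewrite polyC0 subr0 => ->.
  by rewrite expr0 fact0 horner_coef0 m0 polyC1; ring.
have [E IHE] := IH (ltnW lt_nK).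
have szP := size_P_rat n.+1.
rewrite P_ratSS -[X in homogenize _ _ _ X]addn1 homogenizeM; first last.
- by rewrite addrC -polyC1 size_XaddC.
- exact: size_Xderiv.
rewrite reciprocal_Xderiv IHE.
have -> : reciprocal 1 (1 + 'X) = 1 + 'X :> {poly rat}.
  rewrite reciprocalE !big_ord_recl big_ord0 /= !coefD !coef1 !coefX /=.
  by rewrite !addr0 !add0r !scale1r addrC.
have eqY : 'X^(n.+2) * (e * 'X^(K - n.+2)) = m ^+ 2 - (1 + 'X) * (m - 'X * m^`()).
  by rewrite mulrCA -exprD subnKC // eq_m; ring.
(* The terms [(n+1) v^(n+1) E] cancel. The equation for [m] turns [(n+1)! m^n (1 + v) (m - v m')]
   into [(n+1)! m^(n+2)] up to a multiple of [e v^K], and [n + 2 <= K]. *)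
exists (- ((n.+1)`!%:R * m ^+ n * (e * 'X^(K - n.+2))) - (1 + 'X) * E^`()).
rewrite [in RHS](mulrDr 'X^(n.+2)) mulrN (mulrCA 'X^(n.+2)) eqY.
rewrite derivD !derivM -polyC_natr derivC mul0r add0r derivXn polyC_natr /=.
rewrite deriv_exp /= -mulr_natr !factS !natrM -!natr1 !exprS.
ring.
Qed.

Lemma reciprocal_map (A B : comNzRingType) (h : {rmorphism A -> B}) (D : nat)
    (f : {poly A}) :
  reciprocal D (map_poly h f) = map_poly h (reciprocal D f).
Proof.
rewrite !reciprocalE rmorph_sum; apply: eq_bigr => i _.
by rewrite coef_map /= map_polyZ map_polyXn.
Qed.

(** * Comparison of [H(u,t)] with [G(t/tau)] *)

Notation scalar_poly R := (map_poly (polyC \o in_alg R)).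

Definition P_normalized (n : nat) : {poly rat} := (n.-1)`!%:R^-1 *: P_rat n.

Lemma size_P_normalized n : (size (P_normalized n) <= n.+1)%N.
Proof. exact: leq_trans (size_scale_leq _ _) (size_P_rat n). Qed.

(* The substitution [t^n -> t^n P_n(u) / (n-1)!], which maps [G] to [H]. *)
Definition P_transform (R : comAlgType rat) (D : nat) (Q : {poly R}) :
    {poly {poly R}} :=
  \sum_(n < D.+1) (Q`_n *: 'X^n) *: scalar_poly R (P_normalized n).

(** This stands for [v^D Q(t/tau)], with [1/tau] replaced by [m/v]. *)
Notation laurent_subst m :=
  (homogenize (polyC \o polyC) ('X%:P * scalar_poly _ m) 'X).

(** For [n >= 1], [P_n / (n-1)!] and [(m/v)^n] differ by a polynomial in [v]; multiplied by [v^D],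
    the difference is divisible by [v^D]. *)
Lemma reciprocal_P_transform (R : comAlgType rat) (K D : nat) (m e : {poly rat})
    (Q : {poly R}) :
  m`_0 = 1 -> m ^+ 2 = (1 + 'X) * (m - 'X * m^`()) + e * 'X^K -> (D <= K)%N ->
  Q`_0 = 0 ->
  exists E, reciprocal D (P_transform D Q) = laurent_subst m D Q + E * 'X^D.
Proof.
move=> m0 eq_m le_DK Q0.
have /fin_all_exists[E defE] (n : 'I_D.+1) : exists E,
    reciprocal D ((Q`_n *: 'X^n) *: scalar_poly R (P_normalized n)) =
    (polyC \o polyC) Q`_n * ('X%:P * scalar_poly R m) ^+ n * 'X^(D - n) + E * 'X^D.
  have szP := size_P_normalized n.
  case: n szP => -[|n] /= lt_nD szP; rewrite ?ltnS in lt_nD.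
    by exists 0; rewrite homogenizeZ Q0 scale0r !polyC0 !mul0r addr0.
  have [E defE] := reciprocal_P_rat m0 eq_m (leq_trans lt_nD le_DK).
  exists ((Q`_n.+1 *: 'X^(n.+1))%:P * scalar_poly R (n`!%:R^-1 *: E)).
  rewrite homogenizeZ -/(P_normalized _) reciprocal_map.
  rewrite -[X in reciprocal X _](subnKC lt_nD) reciprocal_add //.
  rewrite homogenizeZ defE.
  have -> : (n.+1.-1)`!%:R^-1%:P * (n`!%:R * m ^+ n.+1 + 'X^(n.+1) * E) * 'X^(D - n.+1) =
      m ^+ n.+1 * 'X^(D - n.+1) + (n`!%:R^-1 *: E) * 'X^D.
    have fK : (n`!%:R^-1)%:P * n`!%:R = 1 :> {poly rat}.
      by rewrite -polyC_natr -polyCM mulVf // Num.Theory.pnatr_eq0 -lt0n fact_gt0.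
    rewrite -[in 'X^D](subnKC lt_nD) exprD -mul_polyC mulrDr mulrA fK; ring.
  rewrite rmorphD !rmorphM !rmorphXn /= !map_polyX -mul_polyC.
  rewrite exprMn mulrDr !mulrA polyCM polyC_exp; congr (_ + _).
rewrite /P_transform homogenize_sum (eq_bigr _ (fun n _ => defE n)) big_split /=.
by exists (\sum_i E i); rewrite mulr_suml.
Qed.

Lemma P_transform_sum (R : comAlgType rat) (D : nat) (I : Type) (r : seq I)
    (P : pred I) (F : I -> {poly R}) :
  P_transform D (\sum_(i <- r | P i) F i) =
  \sum_(i <- r | P i) P_transform D (F i).
Proof.
rewrite /P_transform exchange_big; apply: eq_bigr => n _.
by rewrite coef_sum !scaler_suml.
Qed.

Lemma P_transform_monomial (R : comAlgType rat) (D n : nat) (a : R) :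
  (n <= D)%N ->
  P_transform D (a *: 'X^n) = (a *: 'X^n) *: scalar_poly R (P_normalized n).
Proof.
rewrite -ltnS => lt_nD; rewrite /P_transform (bigD1 (Ordinal lt_nD)) //= big1.
  by rewrite coefZ coefXn eqxx mulr1 addr0.
move=> j /negP ne_jn; rewrite coefZ coefXn; case: eqP => [e|_].
  by case: ne_jn; apply/eqP/val_inj.
by rewrite mulr0 !scale0r.
Qed.

Lemma size_G_poly (R : comAlgType rat) (g : nat) (c : 'I_g -> R) :
  (size (G_poly c) <= g.+2)%N.
Proof.
rewrite (leq_trans (size_sum _ _ _)) //; apply/bigmax_leqP => a _.
by rewrite (leq_trans (size_scale_leq _ _)) // size_polyXn !ltnS ltn_ord.
Qed.

(** The factor [(a+1)!] in [G] cancels the normalization of [P_(a+2)]. *)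
Lemma H_polyE (R : comAlgType rat) (g : nat) (c : 'I_g -> R) :
  H_poly c = P_transform g.+1 (G_poly c).
Proof.
rewrite /G_poly P_transform_sum; apply: eq_bigr => a _.
rewrite P_transform_monomial; last by rewrite ltnS.
rewrite /P_normalized /= map_polyZ scalerA /=.
have -> : map_poly (polyC \o in_alg R) (P_rat a.+2) = map_poly intr (P_poly a.+2).
  rewrite /P_rat -map_poly_comp; apply: eq_map_poly => z /=.
  by rewrite -[_%:A]/(in_alg R _) !rmorph_int.
congr (_ *: _); rewrite mulrC mul_polyC scalerA; congr (_ *: _).
rewrite -[_%:A]/(in_alg R _) -(rmorph_nat (in_alg R)) mulrA -rmorphM /=.
by rewrite mulVf ?scale1r ?mul1r // Num.Theory.pnatr_eq0 -lt0n fact_gt0.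
Qed.

(** * Pole orders and the estimate for [H^s] *)

(** Pole order at most [M] is expressed, after multiplication by [v^D], as divisibility by
    [v^(D-M)]. *)
Definition divides_Xn (A : comNzRingType) (n : nat) (f : {poly A}) :=
  exists q, f = q * 'X^n.

Lemma divides_XnD (A : comNzRingType) (n : nat) (f1 f2 : {poly A}) :
  divides_Xn n f1 -> divides_Xn n f2 -> divides_Xn n (f1 + f2).
Proof. by move=> [q1 ->] [q2 ->]; exists (q1 + q2); rewrite mulrDl. Qed.

Lemma divides_Xn_sum (A : comNzRingType) (n : nat) (I : Type) (r : seq I)
    (P : pred I) (F : I -> {poly A}) :
  (forall i, P i -> divides_Xn n (F i)) -> divides_Xn n (\sum_(i <- r | P i) F i).
Proof.
move=> dF; elim/big_ind: _ => //; first by exists 0; rewrite mul0r.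
by move=> f1 f2; exact: divides_XnD.
Qed.

Lemma divides_Xn_mulW (A : comNzRingType) (n k : nat) (q : {poly A}) :
  (n <= k)%N -> divides_Xn n (q * 'X^k).
Proof.
by move=> /subnK <-; rewrite exprD mulrA; exists (q * 'X^(k - n)).
Qed.

Lemma divides_laurent_subst (R : comAlgType rat) (m : {poly rat}) (D M : nat)
    (Q : {poly R}) :
  (size Q <= M.+1)%N -> divides_Xn (D - M) (laurent_subst m D Q).
Proof.
move=> szQ; apply: divides_Xn_sum => i _.
case: (leqP i M) => [le_iM|lt_Mi]; first by apply: divides_Xn_mulW; lia.
by exists 0; rewrite nth_default ?(leq_trans szQ) //= !polyC0 !mul0r.
Qed.

Lemma size_H_exp_sub_P_transform (R : comAlgType rat) (g : nat) (c : 'I_g -> R)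
    (N s : nat) :
  (0 < s)%N -> (forall j, (j < s)%N -> (size (G_poly c ^+ j) <= (N + j).+1)%N) ->
  (size (H_poly c ^+ s - P_transform (g.+1 * s) (G_poly c ^+ s))%R <= N + s)%N.
Proof.
move=> s_gt0 szGj; set G := G_poly c; set w := g.+1.
have szG : (size G <= w.+1)%N by exact: size_G_poly.
have G0 : G`_0 = 0.
  by rewrite coef_sum big1 // => a _; rewrite coefZ coefXn mulr0.
have Gs0 : (G ^+ s)`_0 = 0.
  by rewrite -horner_coef0 horner_exp horner_coef0 G0 expr0n -[s == _]negbK -lt0n s_gt0.
have szPhi D (Q : {poly R}) : (size (P_transform D Q) <= D.+1)%N.
  rewrite (leq_trans (size_sum _ _ _)) //; apply/bigmax_leqP => n _.
  rewrite (leq_trans (size_scale_leq _ _)) // (leq_trans (size_poly _ _)) //.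
  by rewrite (leq_trans (size_P_normalized _)).
have szH : (size (H_poly c) <= w.+1)%N by rewrite H_polyE.
(* One truncation order serves both [G], cleared by [v^w], and [G^s], cleared by [v^(w s)]. *)
have [m [e [m0 eq_m]]] := exists_truncated_v_over_log (w * s).
have le_wK : (w <= (w * s).+1)%N by rewrite leqW // leq_pmulr.
have [E HE] := reciprocal_P_transform m0 eq_m le_wK G0.
have [Es HEs] := reciprocal_P_transform m0 eq_m (leqnSn _) Gs0.
set T := _ - _.
have szT : (size T <= (w * s).+1)%N.
  by rewrite (leq_trans (size_polyD _ _)) // size_polyN geq_max size_exp_le ?szPhi.
have [q def_q] : divides_Xn (w * s - (N + s).-1) (reciprocal (w * s) T).
  rewrite homogenizeB homogenizeX // HEs H_polyE HE.
  (* The last binomial term, [G(t/tau)^s], is also the polar part of the transform of [G^s], so it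
     drops out of [T]. *)
  rewrite [X in X ^+ s]addrC exprDn big_ord_recr /=.
  rewrite -homogenizeX // subnn expr0 mul1r binn mulr1n opprD addrA addrK -mulNr.
  apply: divides_XnD; last by apply: divides_Xn_mulW; exact: leq_subr.
  apply: divides_Xn_sum => j _; rewrite -homogenizeX //.
  have [q ->] := divides_laurent_subst m (w * j) (szGj j (ltn_ord j)).
  rewrite exprMn -exprM -mulr_natr.
  have -> : E ^+ (s - j) * 'X^(w * (s - j)) * (q * 'X^(w * j - (N + j))) * 'C(s, j)%:R =
      (E ^+ (s - j) * q * 'C(s, j)%:R) * 'X^(w * (s - j) + (w * j - (N + j))).
    by rewrite exprD; ring.
  (* The term with index [j] has pole order at most [N + j], and [j < s]. *)
  apply: divides_Xn_mulW.
  have := ltn_ord j; have := leq_mul (leqnn w) (ltnW (ltn_ord j)).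
  by rewrite mulnBr; lia.
apply/leq_sizeP => i le_i.
case: (leqP i (w * s)) => [le_iD|lt_Di]; last by rewrite nth_default // (leq_trans szT).
rewrite -(coef_reciprocal _ le_iD) def_q coefMXn ifT //; lia.
Qed.

(** * The coefficient of [u^(N+s)] in [H^s / (1 + u)] *)

(** For [n > 1] this is [P_n / ((n-1)! (1 + u))], the division being read off the recursion for
    [P_n]. *)
Definition P_quotient (n : nat) : {poly rat} := (n.-1)`!%:R^-1 *: ('X * (P_rat n.-1)^`()).

Lemma P_normalizedE n : (1 < n)%N -> P_normalized n = P_quotient n * (1 + 'X).
Proof.
by case: n => [|[|n]] // _; rewrite /P_normalized P_ratSS scalerAl.
Qed.

Lemma coef_P_quotient_eq0 n i : (1 < n)%N -> (0 < i)%N ->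
  ((P_quotient n)`_i == 0) = (n <= i)%N.
Proof.
case: n i => [|[|n]] [|i] // _ _; rewrite coefZ coefXM /= coef_deriv.
rewrite mulf_eq0 invr_eq0 Num.Theory.pnatr_eq0 -leqn0 leqNgt fact_gt0 /=.
rewrite Num.Theory.mulrn_eq0 /= ltnS; case: leqP => [le_in|lt_ni].
  by apply/negbTE; rewrite Order.POrderTheory.gt_eqF // coef_P_rat_gt0.
by rewrite nth_default ?eqxx // (leq_trans (size_P_rat _)).
Qed.

Lemma size_G_exp_iff_coef_H_quot (R : comAlgType rat) (g : nat) (c : 'I_g -> R)
    (N s : nat) :
  (0 < s)%N -> (forall j, (j < s)%N -> (size (G_poly c ^+ j) <= (N + j).+1)%N) ->
  (size (G_poly c ^+ s) <= (N + s).+1)%N <-> (H_quot c s)`_(N + s) = 0.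
Proof.
move=> s_gt0 szGj; have szT := size_H_exp_sub_P_transform s_gt0 szGj.
set D := (g.+1 * s)%N in szT; set Q := G_poly c ^+ s in szT *.
(* Since [t^2] divides [G^s], only indices [n > 1] matter, where [1 + u] divides [P_n]. *)
have [Q0 Q1] : Q`_0 = 0 /\ Q`_1 = 0.
  have -> : Q = (\sum_(a < g) ((a.+1)`!%:R * c a) *: 'X^a) * G_poly c ^+ s.-1 * 'X^2.
    rewrite /Q -[in LHS](prednK s_gt0) exprS mulrAC; congr (_ * _).
    by rewrite mulr_suml; apply: eq_bigr => a _; rewrite -scalerAl -exprD addn2.
  by rewrite !coefMXn.
pose F : {poly {poly R}} :=
  \sum_(n < D.+1) (Q`_n *: 'X^n) *: scalar_poly R (P_quotient n).
have defF : P_transform D Q = F * (1 + 'X).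
  rewrite mulr_suml; apply: eq_bigr => -[[|[|n]] lt_nD] _ /=;
    rewrite ?Q0 ?Q1 ?scale0r ?mul0r //.
  by rewrite P_normalizedE // rmorphM -scalerAl rmorphD rmorph1 /= map_polyX.
(* Dividing by the monic [1 + u] lowers the degree by one, so the error does not reach [u^(N+s)]. *)
have szTq : (size (H_quot c s - F)%R < N + s)%N.
  have [->|nz] := eqVneq (H_quot c s - F) 0; first by rewrite size_poly0 addn_gt0 s_gt0 orbT.
  move: szT; rewrite -H_quotE // defF -mulrBl size_Mmonic //; last first.
    by rewrite addrC -polyC1 monicXaddC.
  by rewrite [1 + _]addrC -polyC1 size_XaddC addn2.
have coefHF : (H_quot c s)`_(N + s) = F`_(N + s).
  by apply/eqP; rewrite -subr_eq0 -coefB nth_default // ltnW.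
(* Different [n] contribute to different powers of [t], so vanishing can be tested for each [n]
   separately. *)
have -> : (H_quot c s)`_(N + s) =
    \poly_(n < D.+1) (in_alg R (P_quotient n)`_(N + s) * Q`_n).
  rewrite coefHF poly_def coef_sum; apply: eq_bigr => n _.
  by rewrite coefZ coef_map /= [LHS]mulrC mul_polyC scalerA.
have Ns_gt0 : (0 < N + s)%N by rewrite addn_gt0 s_gt0 orbT.
split=> [/leq_sizeP szQ|eq0].
  apply/polyP => n; rewrite coef_poly coef0; case: ifP => // _.
  case: (leqP n (N + s)) => [le_n|lt_n]; last by rewrite szQ ?mulr0.
  case: n le_n => [|[|n]] le_n; rewrite ?Q0 ?Q1 ?mulr0 //.
  have /eqP -> : (P_quotient n.+2)`_(N + s) == 0 by rewrite coef_P_quotient_eq0.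
  by rewrite rmorph0 mul0r.
apply/leq_sizeP => n lt_n.
case: (ltnP n D.+1) => [lt_nD|le_Dn]; last first.
  by rewrite nth_default // (leq_trans _ le_Dn) // size_exp_le ?size_G_poly.
have := congr1 (fun p : {poly R} => p`_n) eq0; rewrite coef_poly lt_nD coef0.
have n_gt1 : (1 < n)%N by lia.
have : (P_quotient n)`_(N + s) != 0 by rewrite coef_P_quotient_eq0 // -ltnNge.
set x := (P_quotient n)`_(N + s) => nz_x eq_x.
(* A nonzero rational is invertible in the algebra [R]. *)
by rewrite -[Q`_n]mul1r -(rmorph1 (in_alg R)) -(mulVf nz_x) rmorphM -mulrA eq_x mulr0.
Qed.

(** The one-step equivalence needs the degree bounds for smaller powers: they are given in one
    direction and come from strong induction in the other. The power [0] is [1] and satisfies its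
    bound. *)
Lemma size_G_exps_iff_coef_H_quots (R : comAlgType rat) (g : nat) (c : 'I_g -> R) (N r : nat) :
  (forall s, (1 <= s <= r)%N -> (size (G_poly c ^+ s) <= (N + s).+1)%N) <->
  (forall s, (1 <= s <= r)%N -> (H_quot c s)`_(N + s) = 0).
Proof.
have step s : (forall j, (1 <= j < s)%N -> (size (G_poly c ^+ j) <= (N + j).+1)%N) ->
    (1 <= s)%N ->
    (size (G_poly c ^+ s) <= (N + s).+1)%N <-> (H_quot c s)`_(N + s) = 0.
  move=> szG s_gt0; apply: size_G_exp_iff_coef_H_quot => // -[|j] lt_js.
    by rewrite size_poly1.
  exact: szG.
split=> [szG s /andP[s_gt0 le_sr]|coefH].
  by apply/step => // [j /andP[j_gt0 lt_js]|]; apply: szG; lia.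
elim/ltn_ind=> s IH /andP[s_gt0 le_sr].
by apply/step => // [j /andP[j_gt0 lt_js]|]; [apply: IH|apply: coefH]; lia.
Qed.

Theorem mainTheorem2
  (* a smooth projective curve of genus g *)
  (k : closedFieldType) (C : kspace k) (g : nat)
  (C_smooth : smooth_curve C) (C_proj : projective C) (C_genus : genus C g)
  (* its Jacobian, with an Abel-Jacobi map *)
  (J : abelian_variety k) (phi : C -> J) (phiP : abel_jacobi phi)
  (* A = A(J), with the Pontryagin product *)
  (A : comAlgType rat) (cl : set J -> A) (AP : pontryagin_chow_ring cl)
  (* R = the subalgebra of A(J) generated by the classes C_(a) *)
  (R : comAlgType rat) (iota : {lrmorphism R -> A}) (c : 'I_g -> R)
  (iota_inj : injective iota)
  (cP : curve_components cl phi (fun a => iota (c a)))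
  (R_gen : generates_algebra c)
  (d r : nat) (r_gt0 : (1 <= r)%N) (le_rd : (r <= d)%N) :
  (forall s, (1 <= s <= r)%N ->
     (* deg_t (G ^ s) <= d - r + s *)
     (size (G_poly c ^+ s) <= (d - r + s).+1)%N)
  <->
  (forall s, (1 <= s <= r)%N -> (H_quot c s)`_(d - r + s) = 0).
Proof. exact: size_G_exps_iff_coef_H_quots. Qed.
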